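(* Let $K$ be a compact metric space and let $\mu \in M(K)$ with $\|\mu\| = 1$. Let $S \subseteq K^\infty$ be the set of all sequences in $K$ which are $\mu$-u.d. Then $|\mu|^\infty(S) = 1$.
   Context: $M(K)$ is the space of finite regular signed (real) Borel measures on $K$, identified with the dual $C(K)^*$ of the space of real continuous functions on $K$, with norm $\|\mu\| = |\mu|(K)$, where $|\mu|$ is the total variation measure. $K^\infty$ is the product of countably many copies of $K$ with the product topology, and for a Borel probability measure $\nu$ on $K$, $\nu^\infty$ is the induced product measure on $K^\infty$, taken to be complete. Definition: for a compact Hausdorff space $K$ and a probability measure $\nu$ on $K$ (regular Borel), a sequence $(x_n)$ in $K$ is $\nu$-u.d. in the classical sense if $\lim_{N\to\infty} \frac1N\sum_{k=1}^N f(x_k) = \int_K f\, d\nu$ for all $f \in C(K)$. For $\mu \in M(K)$ with $\|\mu\|=1$, a sequence $(x_n)$ in $K$ is called $\mu$-u.d. if (1) $(x_n)$ is $|\mu|$-u.d. in the classical sense, and (2) there is a sequence of signs $(\varepsilon_n)$ in $\{\pm 1\}$ such that $\lim_{N \to \infty} \frac{\varepsilon_1 f(x_1) + \dots + \varepsilon_N f(x_N)}{N} = \int_K f\, d\mu$ for all $f \in C(K)$. *)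

(* Defs.v *)
From HB Require Import structures.
From mathcomp Require Import all_boot all_order all_algebra.
From mathcomp Require Import all_classical all_reals all_analysis.
From mathcomp Require Import measurable_realfun.

Set Implicit Arguments.
Unset Strict Implicit.
Unset Printing Implicit Defensive.
Import Order.TTheory GRing.Theory Num.Theory.
Import numFieldNormedType.Exports.

Local Open Scope classical_set_scope.
Local Open Scope ring_scope.
Local Open Scope ereal_scope.

(* Sequences in [X], as an alias so that the semiring of measurable rectangles
   with finitely many proper sides can be its canonical structure. *)
Definition iprod (X : Type) : Type := nat -> X.

Definition rect {X : Type} (A : nat -> set X) : set (iprod X) :=
  [set x | forall i, A i (x i)].

Fact rect_display (d : measure_display) : measure_display. Proof. exact: d. Qed.

Section rectangles.
Context d (X : measurableType d).
Implicit Types (A B : nat -> set X) (n : nat).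

Definition rect_family A n :=
  (forall i, measurable (A i)) /\ (forall i, (n <= i)%N -> A i = setT).

Definition measurable_rect : set (set (iprod X)) :=
  [set E | exists A n, rect_family A n /\ E = rect A].

HB.instance Definition _ := Pointed.on (iprod X).

Let measurable_rect0 : measurable_rect set0.
Proof.
exists (fun i => if i == 0%N then set0 else setT), 1%N; split.
  by split => [[|i]|[|i]//]; [exact: measurable0|exact: measurableT].
by apply/seteqP; split => // x /(_ 0%N).
Qed.

Let measurable_rectI : setI_closed measurable_rect.
Proof.
move=> _ _ [A [n [[mA An] ->]]] [B [m [[mB Bm] ->]]].
exists (fun i => A i `&` B i), (maxn n m); split.
  split => [i|i]; first exact: measurableI.
  by rewrite geq_max => /andP[ni mi]; rewrite An// Bm// setIT.
apply/seteqP; split => [x [xA xB] i|x xAB]; first by split.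
by split => i; have [] := xAB i.
Qed.

Let measurable_rectD : semi_setD_closed measurable_rect.
Proof.
move=> _ _ [A [n [[mA An] ->]]] [B [m [[mB Bm] ->]]].
pose G k i := if (i < k)%N then A i `&` B i
              else if i == k then A i `\` B i else A i.
have GAB k x : rect (G k) x ->
    [/\ rect A x, forall i, (i < k)%N -> B i (x i) & ~ B k (x k)].
  move=> Gx; split => [i|i ik|].
  - by have := Gx i; rewrite /G; case: ifPn => _; [case|case: ifPn => _ //; case].
  - by have := Gx i; rewrite /G ik => -[].
  - by have := Gx k; rewrite /G ltnn eqxx => -[].
exists [set rect (G k) | k in `I_m]; split.
- exact: finite_image.
- move=> _ [k km <-]; exists (G k), (maxn n k.+1); split => //; split => [i|i].
    rewrite /G; case: ifPn => _; first exact: measurableI.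
    by case: ifPn => _ //; exact: measurableD.
  rewrite geq_max => /andP[ni ki].
  by rewrite /G ltnNge (ltnW ki)/= gtn_eqF// An.
- apply/seteqP; split => [x [xA xB]|x [_ [k km <-] xk]].
    have [k kP] : exists k, `[< ~ B k (x k) >].
      by move/existsNP : xB => [k kP]; exists k; exact/asboolP.
    have ex : exists k, `[< ~ B k (x k) >] by exists k.
    case: (ex_minnP ex) => j /asboolP Bj jmin.
    exists (rect (G j)).
      exists j => //=; rewrite ltnNge; apply/negP => mj.
      by apply: Bj; rewrite Bm.
    move=> i; rewrite /G; case: ifPn => [ij|_].
      split => //; apply: contrapT => Bi.
      by have := jmin i (asboolT Bi); rewrite leqNgt ij.
    by case: ifPn => [/eqP ->|_]; [split|exact: xA].
  have [xA _ xB] := GAB _ _ xk.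
  by split => // xB'; exact: (xB (xB' k)).
- move=> _ _ [k km <-] [l lm <-] [x [xk xl]].
  have [_ kB kNB] := GAB _ _ xk; have [_ lB lNB] := GAB _ _ xl.
  case: (ltngtP k l) => [kl|lk|->//]; exfalso.
    by apply: kNB; exact: lB.
  by apply: lNB; exact: kB.
Qed.

HB.instance Definition _ := @isSemiRingOfSets.Build (rect_display d) (iprod X)
  measurable_rect measurable_rect0 measurable_rectI measurable_rectD.

End rectangles.

Section rect_measure.
Context d (X : measurableType d) (R : realType) (P : probability X R).
Implicit Types (A B : nat -> set X) (n : nat).

(* On a nonempty rectangle [rect A] the i-th projection is [A i], and the
   partial products are nonincreasing, so this is the product of the [P (A i)]
   (see [rect_measureE]). *)
Definition rect_measure (E : set (iprod X)) : \bar R :=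
  ereal_inf (range (fun n => \prod_(i < n) P [set x i | x in E])).

Let tail A n k := \prod_(k <= i < n) P (A i).

Let tail_ge0 A n k : 0 <= tail A n k.
Proof. by apply: prode_ge0. Qed.

Let tailS A n k : rect_family A n -> tail A n k = P (A k) * tail A n k.+1.
Proof.
move=> [_ An]; rewrite /tail; case: (ltnP k n) => kn; first by rewrite big_ltn.
by rewrite An// probability_setT mul1e !big_geq// (leq_trans kn).
Qed.

Let tail_geq A n k : (n <= k)%N -> tail A n k = 1.
Proof. by move=> nk; rewrite /tail big_geq. Qed.


Let tail_le1 A n k : (forall i, measurable (A i)) -> tail A n k <= 1.
Proof.
move=> mA; suff : 0 <= tail A n k <= 1 by case/andP.
rewrite /tail; elim/big_ind : _ => [|x y /andP[x0 x1] /andP[y0 y1]|i _].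
- by rewrite lexx lee01.
- by rewrite mule_ge0//= -[1]mule1 lee_pmul.
- by rewrite measure_ge0 probability_le1.
Qed.

Let tailM A n m : rect_family A n ->
  tail A n 0 = (\prod_(0 <= i < m) P (A i)) * tail A n m.
Proof.
move=> An; elim: m => [|m IH]; first by rewrite big_geq// mul1e.
by rewrite IH (tailS _ An) big_nat_recr//= muleA.
Qed.

Let tail_le_prod A n m : rect_family A n ->
  tail A n 0 <= \prod_(0 <= i < m) P (A i).
Proof.
move=> An; rewrite (tailM m An) -[leRHS]mule1.
by apply: lee_wpmul2l; [exact: prode_ge0|exact: tail_le1 (An.1)].
Qed.

Let rect_measure_tail A n : rect_family A n -> rect_measure (rect A) = tail A n 0.
Proof.
move=> An; have [[x xA]|] := pselect (exists x, rect A x).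
  have pA i : [set x i | x in rect A] = A i.
    apply/seteqP; split => [_ [y yA <-]//|z Az].
    exists (fun j => if j == i then z else x j); last by rewrite eqxx.
    by move=> j; case: eqP => [->|].
  apply/eqP; rewrite eq_le; apply/andP; split.
    apply: ge_ereal_inf; exists (\prod_(i < n) P [set x i | x in rect A]).
      by exists n.
    under eq_bigr do rewrite pA.
    by rewrite /tail big_mkord.
  apply: le_ereal_inf_tmp => _ [m _ <-].
  under eq_bigr do rewrite pA.
  by rewrite -(big_mkord xpredT (P \o A)); exact: tail_le_prod.
move=> /forallNP A0.
have [i Ai] : exists i, A i = set0.
  apply: contrapT => /forallNP H; apply: (A0 (fun i => xget point (A i))) => i.
  by have /eqP/set0P := H i; exact: xgetPex.
have rA : rect A = set0 by apply/seteqP; split => // x /A0.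
have -> : tail A n 0 = 0.
  by rewrite (tailM i.+1 An) big_nat_recr//= Ai measure0 mule0 mul0e.
apply/eqP; rewrite eq_le; apply/andP; split.
  apply: ge_ereal_inf; exists 0 => //; exists 1%N => //.
  by rewrite big_ord1 rA image_set0 measure0.
by apply: le_ereal_inf_tmp => _ [m _ <-]; exact: prode_ge0.
Qed.

Lemma rect_measureE A n : rect_family A n ->
  rect_measure (rect A) = \prod_(i < n) P (A i).
Proof. by move=> An; rewrite (rect_measure_tail An) /tail big_mkord. Qed.

Let rect_measure_ge0 E : 0 <= rect_measure E.
Proof. by apply: le_ereal_inf_tmp => _ [m _ <-]; exact: prode_ge0. Qed.

Let greedy (Q : seq X -> Prop) : Q [::] ->
  (forall s, Q s -> exists y, Q (rcons s y)) ->
  exists x : nat -> X, forall k, Q (mkseq x k).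
Proof.
move=> Q0 QS.
have [g gP] : {g : seq X -> X & forall s, Q s -> Q (rcons s (g s))}.
  apply: (@choice _ _ (fun s y => Q s -> Q (rcons s y))) => s.
  have [/QS[y Qy]|nQ] := pselect (Q s); first by exists y.
  by exists point.
pose L := fix L k := if k is j.+1 then rcons (L j) (g (L j)) else [::].
exists (fun k => g (L k)) => k.
have -> : mkseq (fun k => g (L k)) k = L k.
  by elim: k => // k IH; rewrite mkseqS IH.
by elim: k => // k IH; exact: gP.
Qed.

Let cf A (s : seq X) : \bar R :=
  \prod_(0 <= i < size s) (\1_(A i) (nth point s i))%:E.

Let cf_rcons A s y : cf A (rcons s y) = cf A s * (\1_(A (size s)) y)%:E.
Proof.
rewrite /cf size_rcons big_nat_recr//= nth_rcons ltnn eqxx; congr (_ * _).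
by rewrite !big_mkord; apply: eq_bigr => i _; rewrite nth_rcons ltn_ord.
Qed.

Let cf_ge0 A s : 0 <= cf A s.
Proof. by apply: prode_ge0 => i _; rewrite lee_fin. Qed.

Let int_sum (c : nat -> \bar R) (V : nat -> set X) :
  (forall j, 0 <= c j) -> (forall j, measurable (V j)) ->
  \int[P]_y (\sum_(j <oo) c j * (\1_(V j) y)%:E) = \sum_(j <oo) c j * P (V j).
Proof.
move=> c0 mV; rewrite integral_nneseries//; last 2 first.
- move=> j; apply: measurable_funeM; apply/measurable_EFinP.
  exact: measurable_indic.
- by move=> j y _; rewrite mule_ge0// lee_fin.
apply: eq_eseriesr => j _; rewrite ge0_integralZl//.
- by rewrite integral_indic// setIT.
- by apply/measurable_EFinP; exact: measurable_indic.
Qed.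

Let measurable_sum (c : nat -> \bar R) (V : nat -> set X) :
  (forall j, 0 <= c j) -> (forall j, measurable (V j)) ->
  measurable_fun setT (fun y => \sum_(j <oo) c j * (\1_(V j) y)%:E).
Proof.
move=> c0 mV; apply: ge0_emeasurable_sum => // j.
- by move=> y _ _; rewrite mule_ge0// lee_fin.
- move=> _; apply: measurable_funeM; apply/measurable_EFinP.
  exact: measurable_indic.
Qed.

Let step (a b : nat -> \bar R) (U V : nat -> set X) :
  (forall j, 0 <= a j) -> (forall j, 0 <= b j) ->
  (forall j, measurable (U j)) -> (forall j, measurable (V j)) ->
  \sum_(j <oo) a j * P (U j) < \sum_(j <oo) b j * P (V j) ->
  exists y, \sum_(j <oo) a j * (\1_(U j) y)%:E <
            \sum_(j <oo) b j * (\1_(V j) y)%:E.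
Proof.
move=> a0 b0 mU mV ab; apply: contrapT => /forallNP H.
move: ab; apply/negP; rewrite -leNgt -!int_sum//.
apply: ge0_le_integral => //; [|exact: measurable_sum|exact: measurable_sum|].
- by move=> y _; apply: nneseries_ge0 => j _ _; rewrite mule_ge0// lee_fin.
- by move=> y _; rewrite leNgt; apply/negP; exact: H.
Qed.

Let descent (a b : nat -> \bar R) (A B : nat -> nat -> set X) (n m : nat -> nat) :
  (forall j, 0 <= a j) -> (forall j, 0 <= b j) ->
  (forall j, rect_family (A j) (n j)) -> (forall j, rect_family (B j) (m j)) ->
  \sum_(j <oo) a j * rect_measure (rect (A j)) <
    \sum_(j <oo) b j * rect_measure (rect (B j)) ->
  exists x : nat -> X, forall k,
    \sum_(j <oo) a j * cf (A j) (mkseq x k) * tail (A j) (n j) k <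
    \sum_(j <oo) b j * cf (B j) (mkseq x k) * tail (B j) (m j) k.
Proof.
move=> a0 b0 An Bm ab.
have [||x xP] := @greedy (fun s =>
  \sum_(j <oo) a j * cf (A j) s * tail (A j) (n j) (size s) <
  \sum_(j <oo) b j * cf (B j) s * tail (B j) (m j) (size s)).
- move: ab; congr (_ < _); apply: eq_eseriesr => j _.
    by rewrite /cf big_geq// mule1 (rect_measure_tail (An j)).
  by rewrite /cf big_geq// mule1 (rect_measure_tail (Bm j)).
- move=> s sab.
  have [| | | | |y yP] := @step
    (fun j => a j * cf (A j) s * tail (A j) (n j) (size s).+1)
    (fun j => b j * cf (B j) s * tail (B j) (m j) (size s).+1)
    (fun j => A j (size s)) (fun j => B j (size s)).
  + by move=> j; rewrite !mule_ge0.
  + by move=> j; rewrite !mule_ge0.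
  + by move=> j; exact: (An j).1.
  + by move=> j; exact: (Bm j).1.
  + move: sab; congr (_ < _); apply: eq_eseriesr => j _.
      by rewrite (tailS _ (An j)) [P _ * _]muleC muleA.
    by rewrite (tailS _ (Bm j)) [P _ * _]muleC muleA.
  exists y; move: yP; congr (_ < _); apply: eq_eseriesr => j _.
    by rewrite cf_rcons size_rcons !muleA [LHS]muleAC.
  by rewrite cf_rcons size_rcons !muleA [LHS]muleAC.
by exists x => k; have := xP k; rewrite size_mkseq.
Qed.

Let cfE A n x k : rect_family A n -> (n <= k)%N ->
  cf A (mkseq x k) = (\1_(rect A) x)%:E.
Proof.
move=> [_ AT] nk; rewrite /cf size_mkseq indicE.
case: (boolP (x \in rect A)) => [/set_mem xA|/negP xA].
  rewrite big1_seq// => i /andP[_]; rewrite mem_index_iota => /andP[_ ik].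
  by rewrite nth_mkseq// indicE mem_set.
have [i xi] : exists i, ~ A i (x i).
  by apply/existsNP => xA'; apply: xA; exact/mem_set.
have ik : (i < k)%N.
  by rewrite ltnNge; apply/negP => ki; apply: xi; rewrite AT// (leq_trans nk).
rewrite big_mkord (bigD1 (Ordinal ik))//= nth_mkseq// indicE memNset//.
by rewrite mul0e.
Qed.

Let cf_gt0 A x : (forall k, cf A (mkseq x k) != 0) -> rect A x.
Proof.
move=> H i; have := H i.+1; rewrite mkseqS cf_rcons size_mkseq indicE.
by case: (boolP (x i \in A i)) => [/set_mem//|_]; rewrite mule0 eqxx.
Qed.

Let trunc N (u : nat -> \bar R) : (forall j, 0 <= u j) ->
  \sum_(j <oo) (j < N)%N%:R%:E * u j = \sum_(j < N) u j.
Proof.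
move=> u0; rewrite (nneseries_split 0 N); last first.
  by move=> k _; rewrite mule_ge0// lee_fin.
rewrite add0n [X in _ + X]eseries0 ?adde0; last first.
  by move=> i Ni _; rewrite ltnNge Ni mul0e.
by rewrite big_mkord; apply: eq_bigr => i _; rewrite ltn_ord mul1e.
Qed.

Let trunc_assoc N (u v : nat -> \bar R) :
    (forall j, 0 <= u j) -> (forall j, 0 <= v j) ->
  \sum_(j <oo) (j < N)%N%:R%:E * u j * v j = \sum_(j < N) u j * v j.
Proof.
move=> u0 v0.
rewrite -(@trunc N (fun j => u j * v j)); last by move=> j; rewrite mule_ge0.
by apply: eq_eseriesr => j _; rewrite muleA.
Qed.

Let rect_measure_le A n (B : nat -> nat -> set X) (m : nat -> nat) :
  rect_family A n -> (forall j, rect_family (B j) (m j)) ->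
  rect A `<=` \bigcup_j rect (B j) ->
  rect_measure (rect A) <= \sum_(j <oo) rect_measure (rect (B j)).
Proof.
move=> An Bm AB; rewrite leNgt; apply/negP => BA.
have b0 j : 0 <= (j < 1)%N%:R%:E :> \bar R by rewrite lee_fin.
have [|x xP] := @descent (fun=> 1) (fun j => (j < 1)%N%:R%:E) B (fun=> A) m
  (fun=> n) (fun=> lee01) b0 Bm (fun=> An).
  rewrite trunc// big_ord1; move: BA; congr (_ < _).
  by apply: eq_eseriesr => j _; rewrite mul1e.
have {}xP k : \sum_(j <oo) cf (B j) (mkseq x k) * tail (B j) (m j) k <
    cf A (mkseq x k) * tail A n k.
  have := xP k; rewrite (@trunc_assoc 1 (fun=> cf A (mkseq x k)))// big_ord1.
  by congr (_ < _); apply: eq_eseriesr => j _; rewrite mul1e.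
have xA : rect A x.
  apply: cf_gt0 => k; apply/eqP => A0; have := xP k.
  rewrite A0 mul0e ltNge => /negP; apply; apply: nneseries_ge0 => j _ _.
  by rewrite mule_ge0.
have [j _ xB] := AB _ xA.
have := xP (maxn n (m j)).
rewrite (cfE _ An) ?leq_maxl// (tail_geq _ (leq_maxl _ _)) mule1.
rewrite indicE mem_set// ltNge => /negP; apply.
apply: (@le_trans _ _ (\sum_(0 <= i < j.+1)
   cf (B i) (mkseq x (maxn n (m j))) * tail (B i) (m i) (maxn n (m j)))); last first.
  by apply: nneseries_lim_ge => i _ _; rewrite mule_ge0.
rewrite big_nat_recr//= (cfE _ (Bm j)) ?leq_maxr// (tail_geq _ (leq_maxr _ _)).
by rewrite mule1 indicE mem_set//= leeDr// sume_ge0// => i _; rewrite mule_ge0.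
Qed.

Let rect_measure_ge A n (B : nat -> nat -> set X) (m : nat -> nat) N :
  rect_family A n -> (forall j, rect_family (B j) (m j)) ->
  trivIset setT (fun j => rect (B j)) ->
  (forall j, rect (B j) `<=` rect A) ->
  \sum_(j < N) rect_measure (rect (B j)) <= rect_measure (rect A).
Proof.
move=> An Bm tB BA; rewrite leNgt; apply/negP => AB.
have b0 M j : 0 <= (j < M)%N%:R%:E :> \bar R by rewrite lee_fin.
have [|x xP] := @descent (fun j => (j < 1)%N%:R%:E) (fun j => (j < N)%N%:R%:E)
  (fun=> A) B (fun=> n) m (b0 1%N) (b0 N) (fun=> An) Bm.
  by rewrite !trunc// big_ord1.
pose k := maxn n (\max_(j < N) m j).
have := xP k; rewrite (@trunc_assoc 1 (fun=> cf A (mkseq x k)))// big_ord1.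
rewrite (@trunc_assoc N (fun j => cf (B j) (mkseq x k)))//.
rewrite (cfE _ An) ?leq_maxl// (tail_geq _ (leq_maxl _ _)) mule1.
under [ltRHS]eq_bigr => j _.
  have mk : (m j <= k)%N.
    by rewrite (leq_trans _ (leq_maxr _ _))//; exact: (leq_bigmax j).
  rewrite (cfE _ (Bm j) mk) (tail_geq _ mk) mule1; over.
have [[j xB]|/forallNP xB] := pselect (exists j : 'I_N, rect (B j) x).
  rewrite (bigD1 j)//= big1 ?adde0 => [|i ij].
    by rewrite !indicE !mem_set ?ltxx//; exact: BA xB.
  rewrite indicE memNset// => xBi.
  have := tB i j Logic.I Logic.I (ex_intro _ x (conj xBi xB)).
  by move=> /val_inj; apply/eqP.
rewrite big1 => [|i _]; last by rewrite indicE memNset//; exact: xB.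
by apply/negP; rewrite -leNgt lee_fin indicE.
Qed.

Let rect_measure_sigma_additive :
  semi_sigma_additive (rect_measure : set (iprod X) -> \bar R).
Proof.
move=> F mF tF [A [n [An FA]]].
have [B FB] : {B : nat -> (nat -> set X) * nat & forall j,
    rect_family (B j).1 (B j).2 /\ F j = rect (B j).1}.
  apply: (@choice _ _ (fun j (B : (nat -> set X) * nat) =>
    rect_family B.1 B.2 /\ F j = rect B.1)) => j.
  by have [C [m [Cm ->]]] := mF j; exists (C, m).
have FE : F = (fun j => rect (B j).1) by apply/funext => j; have [] := FB j.
have Bm j : rect_family (B j).1 (B j).2 by have [] := FB j.
rewrite FA.
have cF : cvgn (fun n => \sum_(0 <= i < n) rect_measure (F i)).
  by apply: is_cvg_nneseries => *.
have -> : rect_measure (rect A) = \sum_(i <oo) rect_measure (F i).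
  apply/eqP; rewrite eq_le; apply/andP; split.
    rewrite FE; apply: (rect_measure_le An Bm).
    by rewrite -FA FE.
  apply: lime_le => //; apply: nearW => N; rewrite big_mkord FE.
  apply: (rect_measure_ge N An Bm); first by rewrite -FE.
  by move=> j; rewrite -FA FE; move=> x Bx; exists j.
exact: cF.
Qed.

Let rect_measure0 : rect_measure set0 = 0.
Proof.
apply/eqP; rewrite eq_le rect_measure_ge0 andbT.
apply: ge_ereal_inf; exists 0 => //; exists 1%N => //.
by rewrite big_ord1 image_set0 measure0.
Qed.

HB.instance Definition _ := isMeasure.Build _ _ _ rect_measure
  rect_measure0 rect_measure_ge0 rect_measure_sigma_additive.

(* Caratheodory extension from the rectangles: the completion of the product
   probability on the product sigma-algebra of [nat -> X]. *)
Definition power_space : measurableType _ :=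
  caratheodory_type (mu_ext rect_measure).

Definition power_measure : set power_space -> \bar R :=
  @completed_measure_extension _ _ _ rect_measure.

HB.instance Definition _ := Measure.on power_measure.

Lemma power_measure_rect A n : rect_family A n ->
  power_measure (rect A) = \prod_(i < n) P (A i).
Proof.
move=> An; rewrite -(rect_measureE An); apply: measurable_mu_extE.
by exists A, n.
Qed.

Let power_measureT : power_measure setT = 1.
Proof.
have -> : setT = rect (fun=> [set: X]) by apply/seteqP; split.
rewrite (@power_measure_rect _ 0) ?big_ord0//.
Qed.

HB.instance Definition _ :=
  Measure_isProbability.Build _ _ _ power_measure power_measureT.

Lemma power_measure_complete : measure_is_complete power_measure.
Proof. exact: measure_is_complete_caratheodory. Qed.

End rect_measure.
Arguments power_space {d X R} P.
Arguments power_measure {d X R} P _.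

(* [measurableType] requires a base point, so nonemptiness is built in; a space
   carrying a signed measure of norm 1 is nonempty anyway. *)
#[short(type="pmetricType")]
HB.structure Definition PointedMetric (R : numDomainType) :=
  {M of Pointed M & Metric R M}.

Definition borel (K : ptopologicalType) := g_sigma_algebraType (@open K).

Section signed_measure.
Context (R : realType) d (T : measurableType d) (mu : {charge set T -> \bar R}).

(* A chosen Hahn decomposition; by [Hahn_decomposition_uniq] the Jordan parts
   do not depend on the choice on measurable sets. *)
Definition hahn_pos : set T := sval (cid (Hahn_decomposition mu)).
Definition hahn_neg : set T := sval (cid (svalP (cid (Hahn_decomposition mu)))).

Lemma hahnP : hahn_decomposition mu hahn_pos hahn_neg.
Proof. exact: svalP (cid (svalP (cid (Hahn_decomposition mu)))). Qed.

Definition total_variation : set T -> \bar R := charge_variation hahnP.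

HB.instance Definition _ := Measure.on total_variation.

Definition charge_norm : \bar R := total_variation setT.

Definition charge_integral (f : T -> R) : R :=
  (\int[jordan_pos hahnP]_x f x - \int[jordan_neg hahnP]_x f x)%R.

Definition variation_probability (mu1 : charge_norm = 1) : set T -> \bar R :=
  total_variation.

HB.instance Definition _ (mu1 : charge_norm = 1) :=
  Measure.on (variation_probability mu1).
HB.instance Definition _ (mu1 : charge_norm = 1) :=
  Measure_isProbability.Build _ _ _ (variation_probability mu1) mu1.

End signed_measure.

Section uniform_distribution.
Context (R : realType) (K : ptopologicalType).

Definition regular_charge (mu : {charge set (borel K) -> \bar R}) :=
  forall A : set (borel K), measurable A -> forall e : R, (0 < e)%R ->
  exists F U : set K, [/\ closed F, open U, F `<=` A, A `<=` U &
    total_variation mu (U `\` F) < e%:E].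

Definition classical_ud (nu : probability (borel K) R) (x : nat -> K) :=
  forall f : K -> R, continuous f ->
  ((\sum_(k < N) f (x k)) / N%:R)%R @[N --> \oo] -->
    (\int[nu]_y f y)%R.

(* The terms x_1, x_2, ... of a sequence are [x 0], [x 1], ... *)
Definition ud (mu : {charge set (borel K) -> \bar R}) (mu1 : charge_norm mu = 1)
    (x : nat -> K) :=
  classical_ud (variation_probability mu1) x /\
  exists eps : nat -> R, (forall k, eps k = 1%R \/ eps k = (- 1)%R) /\
    forall f : K -> R, continuous f ->
    ((\sum_(k < N) eps k * f (x k)) / N%:R)%R @[N --> \oo] -->
      charge_integral mu f.

End uniform_distribution.

(* Main.v *)
Require Import Defs.
From HB Require Import structures.
From mathcomp Require Import all_boot all_order all_algebra finmap.
From mathcomp Require Import all_classical all_reals all_analysis.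
From mathcomp Require Import measurable_realfun ring lra.

Set Implicit Arguments.
Unset Strict Implicit.
Unset Printing Implicit Defensive.
Import Order.TTheory GRing.Theory Num.Theory.
Import numFieldNormedType.Exports.

Local Open Scope classical_set_scope.
Local Open Scope ring_scope.
Local Open Scope ereal_scope.

(** Let [P], [N] be a Hahn decomposition of [mu].  The polar density of [mu]
    with respect to its variation is [\1_P - \1_N], which takes the values 1
    and -1 only, so along a sequence [x] the natural choice of signs is
    [eps k = \1_P (x k) - \1_N (x k)].  The signed averages of [f] along [x]
    are then ordinary averages of [(\1_P - \1_N) f], and the law of large
    numbers makes them converge to the integral of [f] against [mu].

    The exceptional null set must not depend on [f].  Instead of a countable
    dense family of continuous functions, countably many sets are used.  A
    compact metric space has a countable base; each finite list of base sets
    cuts the space into finitely many cells (the i-th one consists of the points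
    that lie in the i-th set of the list and in none before it), and there are
    countably many cells altogether.  For almost every [x] the frequency of
    visits to each cell, and to its traces on [P] and on [N], converges to its
    mass ([ae_typical]).  Given a continuous [f] and [e > 0], compactness
    provides a list of base sets that covers the space and on each of which [f]
    stays within [e] of a constant ([small_oscillation_cover]); so [f] is
    uniformly [e]-close to a linear combination of indicators of cells, and
    convergence of frequencies gives convergence of averages
    ([cvg_weighted_average]).

    The law of large numbers is thus needed for indicators only.  It follows
    from an exponential bound on the probability that a frequency exceeds its
    expectation by [e] ([frequency_upper_tail]) and the Borel-Cantelli lemma.
    The independence behind the bound is used through the product formula for
    rectangles alone ([exponential_markov]).  Finally the set of sequences that
    are uniformly distributed for [mu] contains a set of full measure, and
    completeness of the power measure makes it measurable. *)

(** * Rectangles and exponential moments *)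

Section rectangle_sides.
Context d (X : measurableType d) (R : realType) (P : probability X R).
Implicit Types (A : set X) (D : nat -> set X) (N n : nat).

Local Notation PP := (power_measure P).

Lemma measurable_rect_power D n :
  rect_family D n -> measurable (rect D : set (power_space P)).
Proof.
by move=> Dn; apply: caratheodory_measurable_mu_ext; exists D, n.
Qed.

(** The N-th side is replaced, not intersected: the lemmas below only narrow a
    side that was the whole space. *)
Definition restrict_side D N A : nat -> set X :=
  fun i => if i == N then A else D i.

Lemma rect_family_restrict_side D n N A : rect_family D n -> measurable A ->
  rect_family (restrict_side D N A) (maxn n N.+1).
Proof.
move=> [mD Dn] mA; split => [i|i]; rewrite /restrict_side.
  by case: ifPn.
by rewrite geq_max => /andP[ni Ni]; rewrite gtn_eqF//; exact: Dn.
Qed.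

Lemma rect_restrict_side D N A : D N = setT ->
  rect (restrict_side D N A) = rect D `&` [set x | A (x N)].
Proof.
move=> DN; apply/seteqP; split => [x xE|x [xD xA] i]; rewrite /restrict_side.
  split => [i|/=]; last by have := xE N; rewrite /restrict_side eqxx.
  by have := xE i; rewrite /restrict_side; case: eqP => [->|]//; rewrite DN.
by case: eqP => [->//|_]; exact: xD.
Qed.

(** This is the form in which independence of the coordinates is used. *)
Lemma power_measure_restrict_side D n N A :
  rect_family D n -> measurable A -> D N = setT ->
  PP (rect (restrict_side D N A)) = P A * PP (rect D).
Proof.
move=> Dn mA DN.
rewrite (power_measure_rect P (rect_family_restrict_side N Dn mA)).
have Dn' : rect_family D (maxn n N.+1).
  by case: Dn => mD Dn; split => // i; rewrite geq_max => /andP[/Dn].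
have Nm : (N < maxn n N.+1)%N by rewrite leq_maxr.
rewrite (power_measure_rect P Dn') (bigD1 (Ordinal Nm))//=.
rewrite [in RHS](bigD1 (Ordinal Nm))//=.
rewrite DN probability_setT mul1e /restrict_side eqxx; congr (_ * _).
by apply: eq_bigr => i /eqP iN; case: eqP => // iN'; case: iN; exact: val_inj.
Qed.

(** Markov's inequality for the exponential of a sum of [N] independent copies
    of the two-valued variable equal to [a] on [A] and to [b] off [A]; the
    bound is [exp (- u)] times the N-th power of the mean of the exponential.
    Splitting on whether [x N] lies in [A] lowers [N] by one and moves the
    threshold [u] to [u - a] or [u - b].  The rectangle [D], unconstrained on
    the first [N] coordinates, records the coordinates already split on. *)
Lemma exponential_markov A (a b u : R) N D n : measurable A ->
    rect_family D n -> (forall i, (i < N)%N -> D i = setT) ->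
  let E := [set x : power_space P |
      (u <= \sum_(k < N) (if x k \in A then a else b))%R] `&` rect D in
  measurable (E : set (power_space P)) /\
  PP E <= (expR (- u) *
     (fine (P A) * expR a + fine (P (~` A)) * expR b) ^+ N)%:E * PP (rect D).
Proof.
move=> mA; elim: N D n u => [|N IH] D n u Dn DN /=.
  have [u0|u0] := leP u 0%R.
    rewrite (_ : _ `&` _ = rect D); last first.
      by apply/seteqP; split => [x []//|x xD]; split => //=; rewrite big_ord0.
    split; first exact: measurable_rect_power Dn.
    rewrite expr0 mulr1 -[leLHS]mul1e lee_wpmul2r//.
    by rewrite lee_fin -expR0 ler_expR oppr_ge0.
  rewrite (_ : _ `&` _ = set0); last first.
    by apply/seteqP; split => // x []/=; rewrite big_ord0 leNgt u0.
  by split => //; rewrite measure0 mule_ge0// lee_fin mulr_ge0// expR_ge0.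
have DN' : D N = setT by exact: DN.
have mAc : measurable (~` A) by exact: measurableC.
have DA := rect_family_restrict_side N Dn mA.
have DAc := rect_family_restrict_side N Dn mAc.
have DT B i : (i < N)%N -> restrict_side D N B i = setT.
  by move=> iN; rewrite /restrict_side ltn_eqF// DN// ltnS ltnW.
have [mE1 E1] := IH _ _ (u - a)%R DA (DT _).
have [mE2 E2] := IH _ _ (u - b)%R DAc (DT _).
set F1 := (X in measurable X) in mE1; set F2 := (X in measurable X) in mE2.
rewrite -/F1 in E1; rewrite -/F2 in E2.
rewrite (_ : _ `&` _ = F1 `|` F2); last first.
  rewrite /F1 /F2 !rect_restrict_side//; apply/seteqP; split => [x []|x].
    rewrite /= big_ord_recr/= => + xD; case: ifPn => xA uS.
      by left; split; [rewrite lerBlDr|split => //; exact: set_mem].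
    right; split; [by rewrite lerBlDr|split => //=].
    by move=> xA'; move/negP : xA; apply; exact: mem_set.
  case=> -[/= + [xD xA]]; rewrite lerBlDr => uS; split => //=;
    rewrite big_ord_recr/=.
  - by rewrite mem_set.
  - by rewrite memNset.
split; first exact: measurableU.
apply: (le_trans (measureU2 _ mE1 mE2)); apply: (le_trans (leeD E1 E2)).
rewrite !(power_measure_restrict_side Dn)// !opprB !expRD exprS.
have : PP (rect D) \is a fin_num.
  by rewrite fin_num_measure//; exact: measurable_rect_power Dn.
move: (PP (rect D)) => [q| |]// _.
rewrite -[P A]fineK ?fin_num_measure// -[P (~` A)]fineK ?fin_num_measure//=.
rewrite -!EFinM lee_fin le_eqVlt; apply/orP; left; apply/eqP.
by rewrite /=; ring.
Qed.

End rectangle_sides.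

(** * The law of large numbers for frequencies *)

(** Invert [1 - z <= exp (- z)], and use that [(1 - z) (1 + z + 2 z^2) >= 1]
    when [z <= 1/2]. *)
Lemma expR_le_quadratic (R : realType) (z : R) :
  (z <= 2^-1 -> expR z <= 1 + z + 2 * z ^+ 2)%R.
Proof.
move=> z2; have z1 : (0 < 1 - z)%R by lra.
apply: (@le_trans _ _ (1 - z)^-1%R).
  rewrite -[expR z]invrK lef_pV2 ?posrE ?invr_gt0 ?expR_gt0//.
  by rewrite -expRN; exact: expR_ge1Dx.
rewrite -[leLHS]mul1r ler_pdivrMr//.
have : (0 <= z ^+ 2 * (1 - 2 * z))%R by rewrite mulr_ge0 ?sqr_ge0//; lra.
by rewrite expr2; nra.
Qed.

(** For the indicator of an event of probability [p], centred at [p + e], the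
    mean of [exp (t Y)] is, for small [t > 0], at most [1 - t e + 8 t^2]: the
    linear term is negative, the mean of [Y] being [- e], and it wins over the
    quadratic one as soon as [t < e / 8]. *)
Lemma exponential_mean_lt1 (R : realType) (p e : R) :
  (0 <= p <= 1 -> 0 < e <= 1 ->
   p * expR (e / 16 * (1 - p - e)) + (1 - p) * expR (e / 16 * (- p - e)) < 1)%R.
Proof.
move=> /andP[p0 p1] /andP[e0 e1].
set t := (e / 16)%R.
have t0 : (0 < t)%R by rewrite divr_gt0.
have te : e = (16 * t)%R by rewrite /t; lra.
clearbody t.
have bound (z : R) : (`|z| <= 2)%R ->
    (expR (t * z) <= 1 + t * z + 8 * t ^+ 2)%R.
  rewrite ler_norml => /andP[z2 z2'].
  apply: (le_trans (expR_le_quadratic _)).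
    have : (0 <= t * (2 - z))%R by rewrite mulr_ge0//; lra.
    by rewrite mulrBr; lra.
  have z4 : (0 <= 4 - z ^+ 2)%R.
    rewrite (_ : 4 - _ = (2 - z) * (2 + z))%R; last by ring.
    by rewrite mulr_ge0//; lra.
  have := mulr_ge0 (sqr_ge0 t) z4; rewrite exprMn mulrBr; lra.
have b1 : (`|1 - p - e| <= 2)%R by rewrite ler_norml; apply/andP; split; lra.
have b2 : (`|- p - e| <= 2)%R by rewrite ler_norml; apply/andP; split; lra.
have q0 : (0 <= 1 - p)%R by lra.
apply: (le_lt_trans
  (lerD (ler_wpM2l p0 (bound _ b1)) (ler_wpM2l q0 (bound _ b2)))).
rewrite [ltLHS](_ : _ = 1 - t * e + 8 * t ^+ 2)%R; last by ring.
by rewrite te expr2; nra.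
Qed.

Section law_of_large_numbers.
Context d (X : measurableType d) (R : realType) (P : probability X R).
Implicit Types (A : set X) (N n : nat).
Local Notation PP := (power_measure P).

Lemma fine_probability_setC A : measurable A ->
  fine (P (~` A)) = (1 - fine (P A))%R.
Proof.
by move=> mA; rewrite probability_setC// -[P A]fineK ?fin_num_measure.
Qed.

(** Large deviations above the mean are exponentially rare.  Deviations below
    the mean are those of the complement of [A] above its mean, so this side is
    enough. *)
Lemma frequency_upper_tail A (e : R) : measurable A -> (0 < e <= 1)%R ->
  exists2 r : R, (0 <= r < 1)%R & forall N,
  let E := [set x : power_space P |
     (N%:R * (fine (P A) + e) <= \sum_(k < N) \1_A (x k))%R] in
  measurable E /\ PP E <= (r ^+ N)%:E.
Proof.
move=> mA e01; set p := fine (P A).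
have pq : fine (P (~` A)) = (1 - p)%R by exact: fine_probability_setC.
have p01 : (0 <= p <= 1)%R.
  rewrite fine_ge0//= -lee_fin fineK ?fin_num_measure//.
  exact: probability_le1.
have r1 := exponential_mean_lt1 p01 e01.
set t := (e / 16)%R in r1.
exists (p * expR (t * (1 - p - e)) + (1 - p) * expR (t * (- p - e)))%R.
  rewrite r1 andbT addr_ge0// mulr_ge0 ?expR_ge0 ?subr_ge0//.
    by case/andP : p01.
  by case/andP : p01.
move=> N; have DT : @rect_family _ X (fun=> setT) 0 by split.
have [] := @exponential_markov _ X R P A (t * (1 - p - e)) (t * (- p - e)) 0 N
  _ _ mA DT (fun _ _ => erefl).
rewrite (_ : _ `&` _ = [set x : power_space P |
     (N%:R * (p + e) <= \sum_(k < N) \1_A (x k))%R]); last first.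
  have t0 : (0 < t)%R by case/andP : e01 => ? _; rewrite divr_gt0.
  have sumE (x : nat -> X) :
    (\sum_(k < N) (if x k \in A then t * (1 - p - e) else t * (- p - e)) =
     t * (\sum_(k < N) \1_A (x k) - N%:R * (p + e)))%R.
    have -> : (N%:R * (p + e) = \sum_(k < N) (p + e))%R.
      by rewrite sumr_const card_ord mulr_natl.
    rewrite -sumrB mulr_sumr.
    by apply: eq_bigr => k _; rewrite indicE; case: (_ \in _); congr (_ * _)%R;
      rewrite /=; lra.
  apply/seteqP; split => [x [/= + _]|x /= xN].
    by rewrite sumE pmulr_rge0// subr_ge0.
  by split => //=; rewrite sumE pmulr_rge0// subr_ge0.
move=> mE PE; split => //; move: PE.
rewrite oppr0 expR0 mul1r pq (power_measure_rect P DT) big_ord0 mule1.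
exact.
Qed.

(** The geometric bound is summable in [N], so Borel-Cantelli applies. *)
Lemma ae_frequency_le A (e : R) : measurable A -> (0 < e <= 1)%R ->
  {ae PP, forall x : power_space P, \forall N \near \oo,
    (\sum_(k < N) \1_A (x k) < N%:R * (fine (P A) + e))%R}.
Proof.
move=> mA e01; have [r /andP[r0 r1] rP] := frequency_upper_tail mA e01.
set E := fun N => [set x : power_space P |
     (N%:R * (fine (P A) + e) <= \sum_(k < N) \1_A (x k))%R].
have mE N : measurable (E N) by have [] := rP N.
have sumE : \sum_(N <oo) PP (E N) < +oo.
  apply: (@le_lt_trans _ _ (((1 - r)^-1)%R%:E)); last exact: ltry.
  apply: lime_le; first by apply: is_cvg_nneseries => *.
  apply: nearW => N.
  apply: (@le_trans _ _ (\sum_(0 <= k < N) (r ^+ k)%:E)).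
    by apply: lee_sum => k _; have [] := rP k.
  rewrite sumEFin lee_fin.
  have [->|rn0] := eqVneq r 0%R.
    rewrite subr0 invr1; case: N => [|N]; first by rewrite big_geq.
    by rewrite big_nat_recl// expr0 big1 ?addr0// => i _; rewrite expr0n.
  have := @geometric_le_lim R N 1 r ler01.
  rewrite lt0r rn0 r0 ger0_norm// mul1r => /(_ isT r1); apply: le_trans.
  by rewrite /series/=; apply: ler_sum => i _; rewrite mul1r.
exists (lim_sup_set E); split.
- apply: bigcap_measurable => // n _; exact: bigcup_measurable.
- exact: lim_sup_set_cvg0.
- move=> x /=; apply: contra_notP => /existsNP[n] /not_implyP[_ xn].
  exists n => //= N nN; rewrite ltNge; apply/negP => NE.
  by apply: xn; exists N.
Qed.

Lemma ae_frequency A : measurable A ->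
  {ae PP, forall x : power_space P,
    ((\sum_(k < N) \1_A (x k)) / N%:R)%R @[N --> \oo] --> fine (P A)}.
Proof.
move=> mA; have mAc : measurable (~` A) by exact: measurableC.
have e01 n : (0 < n.+1%:R^-1 :> R)%R && (n.+1%:R^-1 <= 1 :> R)%R.
  by rewrite invr_gt0 ltr0n/= invf_le1 ?ler1n.
have /ae_foralln := fun n => ae_frequency_le mA (e01 n).
have /ae_foralln := fun n => ae_frequency_le mAc (e01 n).
apply: filterS2 => x Ac Aa; apply/cvgrPdist_le => /= e e0.
have [n _ /(_ n (leqnn n)) ne] := near_infty_natSinv_lt (PosNum e0).
rewrite /= in ne.
near=> N.
have N0 : (0 < N)%N by near: N; exact: nbhs_infty_gt.
have N0' : (0 < N%:R :> R)%R by rewrite ltr0n.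
have aN : (\sum_(k < N) \1_A (x k) < N%:R * (fine (P A) + n.+1%:R^-1))%R.
  by near: N; exact: Aa.
have : (\sum_(k < N) \1_(~` A) (x k) < N%:R * (fine (P (~` A)) + n.+1%:R^-1))%R.
  by near: N; exact: Ac.
rewrite fine_probability_setC//.
rewrite (_ : (\sum_(k < N) _ = N%:R - \sum_(k < N) \1_A (x k))%R); last first.
  have -> : (N%:R = \sum_(k < N) 1 :> R)%R by rewrite sumr_const card_ord.
  rewrite -sumrB.
  by apply: eq_bigr => k _; rewrite !indicE in_setC; case: (_ \in _);
    rewrite ?subrr ?subr0.
move=> cN; set s := (\sum_(k < N) _)%R in aN cN *.
have Nne : (N%:R * n.+1%:R^-1 <= N%:R * e)%R by rewrite ler_wpM2l// ltW.
rewrite distrC ler_norml lerBlDr lerBrDr ler_pdivrMr// ler_pdivlMr//.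
rewrite mulrDr in aN; rewrite mulrDr mulrBr mulr1 in cN.
rewrite !mulrDl mulNr ![(_ * N%:R)%R]mulrC.
move: s (N%:R : R) (N%:R * fine (P A))%R (N%:R * e)%R (N%:R / n.+1%:R)%R
  Nne aN cN => s NR Np Ne Nn *.
by apply/andP; split; lra.
Unshelve. all: by end_near. Qed.

End law_of_large_numbers.

(** * Cells of a countable base *)

Definition open_base (K : topologicalType) (U : nat -> set K) :=
  (forall n, open (U n)) /\
  forall x V, nbhs x V -> exists n, U n x /\ U n `<=` V.

Lemma second_countable_open_base (K : ptopologicalType) :
  @second_countable K -> exists U : nat -> set K, open_base U.
Proof.
move=> [B cB [oB nB]].
have [B0|[h]] := pfcard_geP cB.
  have [V [+ _] _] := nB point setT filterT.
  by rewrite B0.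
exists h; split => [n|x V /nB[W [BW Wx] WV]]; first by apply: oB; exact: funS.
have [n _ hn] := 'surj_h BW.
by exists n; rewrite hn.
Qed.

Section cells.
Context (T : Type) (U : nat -> set T).

(** Taking the first set of the list that contains the point makes the cells
    disjoint whatever the overlaps of the [U j].  A point in none of them falls
    in the cell of index [size s], since [find] then returns the size. *)
Definition cell (s : seq nat) (i : nat) : set T :=
  [set x | find (fun j => x \in U j) s = i].

Lemma cell_sub s i : (i < size s)%N -> cell s i `<=` U (nth 0%N s i).
Proof.
move=> si x; rewrite /cell /= => fi; apply/set_mem.
rewrite -[X in nth _ _ X]fi.
by apply: (@nth_find _ 0%N (fun j => x \in U j)); rewrite has_find fi.
Qed.

Lemma sum_cell (R : nzRingType) (s : seq nat) x :
  (exists2 j, j \in s & U j x) ->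
  (\sum_(i < size s) \1_(cell s i) x = 1 :> R)%R.
Proof.
move=> [j js jx].
have fs : (find (fun j => x \in U j) s < size s)%N.
  by rewrite -has_find; apply/hasP; exists j => //; exact: mem_set.
rewrite (bigD1 (Ordinal fs))//= big1 => [|i /eqP si].
  by rewrite addr0 indicE mem_set.
rewrite indicE memNset//= => fi; apply: si; exact/val_inj.
Qed.

End cells.

Lemma measurable_cell d (T : measurableType d) (U : nat -> set T) s i :
  (forall n, measurable (U n)) -> measurable (cell U s i).
Proof.
move=> mU; elim: s i => [|j s IH] i.
  have [i0|i0] := eqVneq i 0%N.
    rewrite (_ : cell _ _ _ = setT)//.
    by apply/seteqP; split => // x _; rewrite /cell /= i0.
  rewrite (_ : cell _ _ _ = set0)//; apply/seteqP; split => // x /= i0'.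
  by move: i0; rewrite -i0'.
case: i => [|i].
  rewrite (_ : cell _ _ _ = U j)//; apply/seteqP; split => x; rewrite /cell/=.
    by case: ifPn => // /set_mem.
  by move=> jx; rewrite mem_set.
rewrite (_ : cell _ _ _ = ~` U j `&` cell U s i).
  by apply: measurableI => //; exact: measurableC.
apply/seteqP; split => x; rewrite /cell/=.
  case: ifPn => // jx [<-]; split => // xj.
  by move/negP : jx; apply; exact/mem_set.
by move=> [jx <-]; rewrite memNset.
Qed.

(** * From frequencies of cells to averages of continuous functions *)

(** Near each point a base set keeps [f] within [e] of its value there;
    compactness keeps finitely many of these base sets. *)
Lemma small_oscillation_cover (R : realType) (K : ptopologicalType)
    (U : nat -> set K) (f : K -> R) (e : R) :
  compact [set: K] -> open_base U -> continuous f -> (0 < e)%R ->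
  exists s : seq nat, exists c : nat -> R,
    (forall x, exists2 j, j \in s & U j x) /\
    (forall j, j \in s -> forall x, U j x -> (`|f x - c j| <= e)%R).
Proof.
rewrite compact_cover => cK [oU nU] cf e0.
pose D := [set j | exists c : R, forall x, U j x -> (`|f x - c| <= e)%R].
have [|x _|D' D'D D'K] := cK nat D U; first by move=> i _; exact: oU.
  have /cvgrPdist_le/(_ _ e0)/nU[n [xn nV]] := cf x.
  by exists n => //; exists (f x) => y /nV; rewrite distrC.
have [c cP] : {c : nat -> R & forall j, j \in D' ->
    forall x, U j x -> (`|f x - c j| <= e)%R}.
  apply: (@choice _ _ (fun j (c : R) => j \in D' ->
    forall x, U j x -> (`|f x - c| <= e)%R)) => j.
  have [jD|jD] := boolP (j \in D'); last by exists 0%R.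
  by have /set_mem[c cj] := D'D _ jD; exists c.
exists (enum_fset D'), c; split => // x.
by have [j jD jx] := D'K x Logic.I; exists j.
Qed.

Lemma measurable_open_borel (K : ptopologicalType) (V : set (borel K)) :
  open (V : set K) -> measurable V.
Proof. by move=> oV; exact: sub_sigma_algebra. Qed.

Lemma continuous_borel_measurable (R : realType) (K : ptopologicalType)
    (f : K -> R) : continuous f -> measurable_fun [set: borel K] f.
Proof.
move=> /continuousP cf; apply: (measurability _ (RGenOpens.measurableE R)).
move=> _ [_ [a [b ->] <-]]; rewrite setTI; apply: measurable_open_borel.
exact/cf/interval_open.
Qed.

Lemma continuous_borel_integrable (R : realType) (K : ptopologicalType)
    (lam : {finite_measure set (borel K) -> \bar R}) (f : K -> R) :
  compact [set: K] -> continuous f ->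
  lam.-integrable [set: borel K] (EFin \o f).
Proof.
move=> cK cf; apply: measurable_bounded_integrable => //.
- by rewrite -ge0_fin_numE// fin_num_measure.
- exact: continuous_borel_measurable.
- have /compact_bounded[M [Mr fM]] :=
    continuous_compact (continuous_subspaceT cf) cK.
  by exists M; split => // x Mx y _; apply: fM => //; exists y.
Qed.

Lemma simple_integral d (T : measurableType d) (R : realType)
    (lam : {finite_measure set T -> \bar R}) n (c : 'I_n -> R)
    (A : 'I_n -> set T) : (forall i, measurable (A i)) ->
  lam.-integrable setT (EFin \o (fun y => \sum_(i < n) c i * \1_(A i) y)%R) /\
  (\int[lam]_y (\sum_(i < n) c i * \1_(A i) y) =
   \sum_(i < n) c i * fine (lam (A i)))%R.
Proof.
move=> mA.
have lamy i : lam (A i) < +oo by rewrite -ge0_fin_numE// fin_num_measure.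
have intA i : lam.-integrable setT (fun y => (\1_(A i) y)%:E).
  by apply: integrable_indic => //; rewrite -ge0_fin_numE// fin_num_measure.
have intcA i : lam.-integrable setT (fun y => (c i * \1_(A i) y)%:E).
  by under eq_fun do rewrite EFinM; exact: integrableZl.
have E : EFin \o (fun y => \sum_(i < n) c i * \1_(A i) y)%R =
    (fun y => \sum_(i < n) (c i * \1_(A i) y)%:E).
  by apply/funext => y; rewrite /= sumEFin.
split; first by rewrite E; exact: integrable_sum.
rewrite /Rintegral (_ : \int[lam]_y _ = \int[lam]_y
   (\sum_(i < n) (c i * \1_(A i) y)%:E)); last first.
  by apply: eq_integral => y _; rewrite sumEFin.
rewrite integral_sum//.
rewrite (eq_bigr (fun i => (c i * fine (lam (A i)))%:E)) ?sumEFin// => i _.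
under eq_integral do rewrite EFinM.
by rewrite integralZl// integral_indic// setIT EFinM fineK ?fin_num_measure.
Qed.

(** The weights [w] make one statement cover the plain averages ([w = 1]) and
    the averages over the visits to a part of the space ([w] its indicator
    along [x]).  Up to a uniform error [de], [f] is a step function [h]
    on cells; replacing [f] by [h] moves the averages by at most [de] and the
    integral by at most [de] times the total mass. *)
Lemma cvg_weighted_average (R : realType) (K : ptopologicalType)
    (U : nat -> set K) (lam : {finite_measure set (borel K) -> \bar R})
    (w : nat -> R) (x : nat -> K) :
  compact [set: K] -> open_base U -> (forall k, `|w k| <= 1)%R ->
  (forall s i, ((\sum_(k < N) w k * \1_(cell U s i) (x k)) / N%:R)%R
     @[N --> \oo] --> fine (lam (cell U s i))) ->
  forall f : K -> R, continuous f ->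
  ((\sum_(k < N) w k * f (x k)) / N%:R)%R @[N --> \oo] -->
    (\int[lam]_y f y)%R.
Proof.
move=> cK oU w1 wcell f cf.
apply/cvgrPdist_le => /= e e0.
set L := fine (lam setT).
have L0 : (0 <= L)%R by exact: fine_ge0.
pose de := (e / (2 + L))%R.
have de0 : (0 < de)%R by rewrite divr_gt0// ltr_pwDl.
have [s [c [sU cU]]] := small_oscillation_cover cK oU cf de0.
pose h y := (\sum_(i < size s) c (nth 0%N s i) * \1_(cell U s i) y)%R.
have mcell i : measurable (cell U s i : set (borel K)).
  by apply: measurable_cell => n; apply: measurable_open_borel; exact: oU.1.
have [inth inthE] := simple_integral lam
  (fun i : 'I_(size s) => c (nth 0%N s i)) (fun i => mcell (nat_of_ord i)).
have intf := continuous_borel_integrable lam cK cf.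
have fh y : (`|f y - h y| <= de)%R.
  rewrite -[f y]mulr1 -(sum_cell R (sU y)) mulr_sumr -sumrB.
  apply: (le_trans (ler_norm_sum _ _ _)).
  rewrite -[leRHS]mulr1 -(sum_cell R (sU y)) mulr_sumr; apply: ler_sum => i _.
  rewrite -mulrBl normrM [X in (_ * X <= _)%R]ger0_norm// indicE.
  have [/set_mem yi|_] := boolP (y \in _); last by rewrite !mulr0.
  rewrite !mulr1; apply: cU; first exact: mem_nth.
  exact: cell_sub yi.
have int_fh : (`|\int[lam]_y f y - \int[lam]_y h y| <= de * L)%R.
  rewrite -RintegralB//; have intfh := integrableB measurableT intf inth.
  apply: (le_trans (le_normr_Rintegral _ _)) => //.
  rewrite -Rintegral_cst//; apply: le_Rintegral => //.
  - exact: integrable_norm.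
  - exact: finite_measure_integrable_cst.
have avg_fh N : (`|(\sum_(k < N) w k * f (x k)) / N%:R -
                   (\sum_(k < N) w k * h (x k)) / N%:R| <= de)%R.
  rewrite -mulrBl -sumrB normrM normfV normr_nat.
  case: N => [|N]; first by rewrite invr0 mulr0 ltW.
  rewrite ler_pdivrMr// (le_trans (ler_norm_sum _ _ _))//.
  rewrite (_ : de * _ = \sum_(k < N.+1) de)%R; last first.
    by rewrite sumr_const card_ord mulr_natr.
  apply: ler_sum => k _; rewrite -mulrBr normrM -[leRHS]mul1r.
  exact: ler_pM.
have avg_h : ((\sum_(k < N) w k * h (x k)) / N%:R)%R @[N --> \oo] -->
    (\int[lam]_y h y)%R.
  rewrite inthE.
  rewrite (_ : (fun N => _) = (fun N : nat => \sum_(i < size s)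
     c (nth 0%N s i) *
       ((\sum_(k < N) w k * \1_(cell U s i) (x k)) / N%:R))%R); last first.
    apply/funext => N; rewrite mulr_suml.
    under [RHS]eq_bigr do rewrite mulrA mulr_sumr mulr_suml.
    rewrite exchange_big/=; apply: eq_bigr => k _.
    rewrite mulr_sumr mulr_suml; apply: eq_bigr => i _.
    by rewrite mulrCA.
  apply: (cvg_big (@add_continuous _)) => i _.
  by apply: cvgMl_tmp; exact: wcell.
near=> N.
have hN : (`|\int[lam]_y h y - (\sum_(k < N) w k * h (x k)) / N%:R| <= de)%R.
  by near: N; move/cvgrPdist_le : avg_h; exact.
have {}avg_fh := avg_fh N.
have deE : (e = de * L + de + de)%R.
  rewrite -{2 3}[de]mulr1 -!mulrDr /de (_ : L + 1 + 1 = 2 + L)%R; last by ring.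
  by rewrite divfK// gt_eqF// ltr_pwDl.
rewrite deE; apply: (le_trans (ler_distD (\int[lam]_y h y)%R _ _)).
rewrite -addrA lerD//; apply: (le_trans (ler_distD
  ((\sum_(k < N) w k * h (x k)) / N%:R)%R _ _)).
by rewrite lerD// distrC.
Unshelve. all: by end_near. Qed.

(** * Typical sequences are uniformly distributed *)

Section jordan_parts.
Context (R : realType) d (T : measurableType d) (mu : {charge set T -> \bar R}).

Let jordan_posI A : measurable A ->
  jordan_pos (hahnP mu) A = mu (A `&` hahn_pos mu).
Proof. by move=> mA; rewrite jordan_posE cjordan_posE /crestr0 mem_set. Qed.

Let jordan_negI A : measurable A ->
  jordan_neg (hahnP mu) A = - mu (A `&` hahn_neg mu).
Proof. by move=> mA; rewrite jordan_negE cjordan_negE /crestr0 mem_set. Qed.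

(** On [hahn_pos mu] the negative part vanishes, so visits to a set within
    [hahn_pos mu] have the positive part as their limit frequency. *)
Lemma total_variation_hahn_pos A : measurable A ->
  Defs.total_variation mu (A `&` hahn_pos mu) = jordan_pos (hahnP mu) A.
Proof.
move=> mA; have [[mP _] _ _ PN0] := hahnP mu.
have mAP : measurable (A `&` hahn_pos mu) by exact: measurableI.
rewrite /Defs.total_variation /charge_variation jordan_negI// !jordan_posI//.
by rewrite -!setIA PN0 setIid setI0 charge0 oppe0 adde0.
Qed.

Lemma total_variation_hahn_neg A : measurable A ->
  Defs.total_variation mu (A `&` hahn_neg mu) = jordan_neg (hahnP mu) A.
Proof.
move=> mA; have [_ [mN _] _ PN0] := hahnP mu.
have mAN : measurable (A `&` hahn_neg mu) by exact: measurableI.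
rewrite /Defs.total_variation /charge_variation jordan_posI// !jordan_negI//.
by rewrite -!setIA [hahn_neg mu `&` _]setIC PN0 setIid setI0 charge0 add0e.
Qed.

End jordan_parts.

Section typical_sequences.
Context (R : realType) (K : ptopologicalType)
  (mu : {charge set (borel K) -> \bar R}) (mu1 : charge_norm mu = 1).
Local Notation nu := (variation_probability mu1).

(** Keeping [B = setT] besides the two Hahn pieces lets the unsigned averages be
    treated without adding up those over the pieces. *)
Definition typical (U : nat -> set K) (x : nat -> K) :=
  forall s i (B : set K), B \in [:: setT; hahn_pos mu; hahn_neg mu] ->
  ((\sum_(k < N) \1_(cell U s i `&` B) (x k)) / N%:R)%R @[N --> \oo] -->
  fine (nu (cell U s i `&` B)).

Lemma ae_typical (U : nat -> set K) : open_base U ->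
  {ae power_measure nu, forall x : power_space nu, typical U x}.
Proof.
move=> [oU _].
have [[mP _] [mN _] _ _] := hahnP mu.
have mcell s i : measurable (cell U s i : set (borel K)).
  by apply: measurable_cell => n; exact: measurable_open_borel.
(* the lists of base sets are enumerated through their natural codes *)
pose sq (n : nat) : seq nat := odflt [::] (choice.unpickle n).
pose B j : set (borel K) := nth setT [:: setT; hahn_pos mu; hahn_neg mu] j.
have mB j : measurable (B j).
  by rewrite /B; case: j => [|[|[|j]]]//=; rewrite nth_nil.
have H : {ae power_measure nu, forall x : power_space nu, forall n i j,
    ((\sum_(k < N) \1_(cell U (sq n) i `&` B j) (x k)) / N%:R)%R
      @[N --> \oo] --> fine (nu (cell U (sq n) i `&` B j))}.
  apply: ae_foralln => n; apply: ae_foralln => i; apply: ae_foralln => j.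
  by apply: ae_frequency; exact: measurableI.
apply: filterS H => x xH s i C CB.
have := xH (choice.pickle s) i (index C [:: setT; hahn_pos mu; hahn_neg mu]).
by rewrite /sq choice.pickleK/= /B nth_index.
Qed.

Lemma typical_ud (U : nat -> set K) (x : nat -> K) :
  compact [set: K] -> open_base U -> typical U x -> ud mu1 x.
Proof.
move=> cK oU xU.
have [[mP _] [mN _] PNT PN0] := hahnP mu.
have mcell s i : measurable (cell U s i : set (borel K)).
  by apply: measurable_cell => n; apply: measurable_open_borel; exact: oU.1.
have ind1 (A : set K) y : (`|\1_A y : R| <= 1)%R.
  by rewrite indicE normr_nat lern1 leq_b1.
have split_freq s i (B : set K) N :
    (\sum_(k < N) \1_(cell U s i `&` B) (x k) =
     \sum_(k < N) \1_B (x k) * \1_(cell U s i) (x k) :> R)%R.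
  by apply: eq_bigr => k _; rewrite indicI mulrC.
have avg_pos (f : K -> R) : continuous f ->
  ((\sum_(k < N) \1_(hahn_pos mu) (x k) * f (x k)) / N%:R)%R @[N --> \oo] -->
    (\int[jordan_pos (hahnP mu)]_y f y)%R.
  apply: (@cvg_weighted_average R K U (jordan_pos (hahnP mu))
    (fun k => \1_(hahn_pos mu) (x k)) x cK oU) => // s i.
  rewrite [X in _ --> fine X](_ : _ = nu (cell U s i `&` hahn_pos mu));
    last exact/esym/total_variation_hahn_pos.
  have := xU s i (hahn_pos mu); rewrite !inE eqxx orbT => /(_ isT).
  by under eq_fun do rewrite split_freq.
have avg_neg (f : K -> R) : continuous f ->
  ((\sum_(k < N) \1_(hahn_neg mu) (x k) * f (x k)) / N%:R)%R @[N --> \oo] -->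
    (\int[jordan_neg (hahnP mu)]_y f y)%R.
  apply: (@cvg_weighted_average R K U (jordan_neg (hahnP mu))
    (fun k => \1_(hahn_neg mu) (x k)) x cK oU) => // s i.
  rewrite [X in _ --> fine X](_ : _ = nu (cell U s i `&` hahn_neg mu));
    last exact/esym/total_variation_hahn_neg.
  have := xU s i (hahn_neg mu); rewrite !inE eqxx !orbT => /(_ isT).
  by under eq_fun do rewrite split_freq.
split => [f cf|].
  have := @cvg_weighted_average R K U nu (fun=> 1%R) x cK oU _ _ f cf.
  under eq_fun do under eq_bigr do rewrite mul1r.
  apply => [k|s i]; first by rewrite normr1.
  under eq_fun do under eq_bigr do rewrite mul1r.
  by have := xU s i setT; rewrite setIT !inE eqxx => /(_ isT).
exists (fun k => \1_(hahn_pos mu) (x k) - \1_(hahn_neg mu) (x k))%R; split.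
  move=> k; have : setT (x k) by [].
  rewrite -PNT => -[xP|xN]; [left|right].
    rewrite !indicE mem_set// memNset ?subr0// => xN.
    suff : set0 (x k) by [].
    by rewrite -PN0.
  rewrite !indicE [X in (_ - (nat_of_bool X)%:R)%R]mem_set// memNset ?sub0r//.
  move=> xP.
  suff : set0 (x k) by [].
  by rewrite -PN0.
move=> f cf.
rewrite (_ : (fun N => _) = (fun N : nat =>
    (\sum_(k < N) \1_(hahn_pos mu) (x k) * f (x k)) / N%:R -
    (\sum_(k < N) \1_(hahn_neg mu) (x k) * f (x k)) / N%:R)%R); last first.
  apply/funext => N; rewrite -mulrBl -sumrB.
  by congr (_ / _)%R; apply: eq_bigr => k _; rewrite mulrBl.
by apply: cvgB; [exact: avg_pos|exact: avg_neg].
Qed.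

End typical_sequences.

Theorem theorem5 (R : realType) (K : pmetricType R)
    (K_compact : compact [set: K])
    (mu : {charge set (borel K) -> \bar R})
    (mu_regular : regular_charge mu)
    (mu_norm1 : charge_norm mu = 1)
    (S : set (power_space (variation_probability mu_norm1)))
    (S_def : S = [set x | ud mu_norm1 x]) :
  measurable S /\ power_measure (variation_probability mu_norm1) S = 1.
Proof.
have [U oU] := second_countable_open_base (compact_second_countable K_compact).
have negS : (power_measure (variation_probability mu_norm1)).-negligible (~` S).
  rewrite S_def; have [Z [mZ Z0 ZU]] := ae_typical mu_norm1 oU.
  exists Z; split => // x xS; apply: ZU => xU; apply: xS.
  exact: typical_ud K_compact oU xU.
have mSc : measurable (~` S) := power_measure_complete negS.
have mS : measurable S by rewrite -[S]setCK; exact: measurableC.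
split => //; rewrite -[S]setCK probability_setC//.
by rewrite (measure_negligible mSc negS) sube0.
Qed.
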